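(* Let $\mathcal{G}$ be the space of group multiplication tables on $\mathbb{N}$ with identity $1$. For every countably infinite algebraically closed group $A$, the set $\{G\in\mathcal{G}:\ \widetilde G\cong A\}$ is dense in $\mathcal{G}$.
   Context: $\mathbb{N}=\{1,2,3,\dots\}$. $\mathcal{G}\subseteq\mathbb{N}^{\mathbb{N}\times\mathbb{N}}$ (product of discrete spaces) is the subspace of those $A$ such that $(i,j)\mapsto A(i,j)$ is the multiplication of a group on $\mathbb{N}$ with identity element $1$. For $G\in\mathcal{G}$, $\widetilde G$ is the group on $\mathbb{N}$ with multiplication table $G$. A group $G$ is algebraically closed if every finite system of equations and inequations with constants from $G$ that is solvable in some group containing $G$ is solvable in $G$. *)

(* Defs.v *)
From HB Require Import structures.
From mathcomp Require Import all_boot all_order all_algebra.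
From mathcomp Require Import all_classical topology.

Set Implicit Arguments.
Unset Strict Implicit.
Unset Printing Implicit Defensive.

Local Open Scope classical_set_scope.
Local Open Scope group_scope.

Definition posnat : Type := {n : nat | (0 < n)%N}.

HB.instance Definition _ := Choice.on posnat.
HB.instance Definition _ := hasNbhs.Build posnat principal_filter.
HB.instance Definition _ := Discrete_ofNbhs.Build posnat erefl.

Definition pos1 : posnat := exist (fun n => (0 < n)%N) 1%N isT.

(* [prod_topology] is the product topology on the set of all functions from
   posnat * posnat to the discrete space posnat. *)
Definition table : Type := {ptws (posnat * posnat) -> posnat}.

HB.instance Definition _ := Topological.on table.

Definition table_mul (M : table) (i j : posnat) : posnat := M (i, j).

(* Used below as a type, [group_tables] carries the subspace topology. *)
Definition group_tables : set table := [set M |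
  [/\ associative (table_mul M),
      left_id pos1 (table_mul M),
      right_id pos1 (table_mul M) &
      forall i, exists j, table_mul M j i = pos1 /\ table_mul M i j = pos1]].

Definition table_group (G : group_tables) : Type := posnat.

Section TableGroup.
Variable G : group_tables.

Let M : table := set_val G.

Let M_group : group_tables M.
Proof. exact: set_valP. Qed.

Let inv_ex (i : posnat) :
  exists j, table_mul M j i = pos1 /\ table_mul M i j = pos1.
Proof. by case: M_group. Qed.

Definition table_inv (i : posnat) : posnat := sval (cid (inv_ex i)).

Fact table_mulA : associative (table_mul M).
Proof. by case: M_group. Qed.

Fact table_mul1 : left_id pos1 (table_mul M).
Proof. by case: M_group. Qed.

Fact table_mulr1 : right_id pos1 (table_mul M).
Proof. by case: M_group. Qed.

Fact table_mulV : left_inverse pos1 table_inv (table_mul M).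
Proof. by move=> i; rewrite /table_inv; case: cid => j []. Qed.

Fact table_mulrV : right_inverse pos1 table_inv (table_mul M).
Proof. by move=> i; rewrite /table_inv; case: cid => j []. Qed.

HB.instance Definition _ := Choice.copy (table_group G) posnat.
HB.instance Definition _ := isGroup.Build (table_group G)
  table_mulA table_mul1 table_mulr1 table_mulV table_mulrV.

End TableGroup.

Definition isomorphic (G H : groupType) : Prop :=
  exists f : {multiplicative G -> H}, bijective f.

Inductive gterm (G : Type) (n : nat) : Type :=
  | Const of G
  | Var of 'I_n
  | One
  | Mul of gterm G n & gterm G n
  | Inv of gterm G n.

Fixpoint geval (G : Type) (H : groupType) (f : G -> H) (n : nat)
    (x : 'I_n -> H) (t : gterm G n) : H :=
  match t with
  | Const c => f c
  | Var i => x i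
  | One => 1
  | Mul t1 t2 => geval f x t1 * geval f x t2
  | Inv t1 => (geval f x t1)^-1
  end.

Record gsystem (G : Type) (n : nat) : Type := GSystem {
  equations : seq (gterm G n * gterm G n);
  inequations : seq (gterm G n * gterm G n)
}.

(* [f] interprets the constants of [S] in [H]. *)
Definition solvable_along (G : Type) (H : groupType) (f : G -> H) (n : nat)
    (S : gsystem G n) : Prop :=
  exists x : 'I_n -> H,
    all (fun e => geval f x e.1 == geval f x e.2) (equations S) /\
    all (fun e => geval f x e.1 != geval f x e.2) (inequations S).

(* A group containing [G] is given by a group [H] and an embedding [f] of [G]
   into [H]. *)
Definition algebraically_closed (G : groupType) : Prop :=
  forall (n : nat) (S : gsystem G n),
    (exists (H : groupType) (f : {multiplicative G -> H}),
       injective f /\ solvable_along f S) ->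
    solvable_along (@idfun G) S.

(* Main.v *)
Require Import Defs.
From HB Require Import structures.
From mathcomp Require Import all_boot all_order all_algebra.
From mathcomp Require Import all_classical topology.

(** A basic open set prescribes finitely many entries of a table [M].  These
    entries, together with the distinctness of the elements occurring in them,
    form a finite system without constants which is solvable in [A * K], where
    [K] is the group with table [M]; so it is solvable in [A].  The resulting
    finite partial injection from N to [A] extends to a bijection, along which
    the multiplication of [A] is transported to N. *)

Set Implicit Arguments.
Unset Strict Implicit.
Unset Printing Implicit Defensive.

Local Open Scope classical_set_scope.

Section DirectProduct.
Local Open Scope group_scope.
Variables G H : groupType.

Let mul (x y : G * H) : G * H := (x.1 * y.1, x.2 * y.2).
Let inv (x : G * H) : G * H := (x.1^-1, x.2^-1).

Let mulA : associative mul.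
Proof. by move=> x y z; rewrite /mul /= !mulgA. Qed.

Let mul1 : left_id (1, 1) mul.
Proof. by case=> a b; rewrite /mul /= !mul1g. Qed.

Let mulr1 : right_id (1, 1) mul.
Proof. by case=> a b; rewrite /mul /= !mulg1. Qed.

Let mulV : left_inverse (1, 1) inv mul.
Proof. by case=> a b; rewrite /mul /inv /= !mulVg. Qed.

Let mulrV : right_inverse (1, 1) inv mul.
Proof. by case=> a b; rewrite /mul /inv /= !mulgV. Qed.

HB.instance Definition _ :=
  isGroup.Build (G * H)%type mulA mul1 mulr1 mulV mulrV.

Definition inj_prodl (x : G) : G * H := (x, 1).

Let inj_prodlM : {morph inj_prodl : x y / x * y}.
Proof. by move=> x y; congr (_, _); rewrite mulg1. Qed.

HB.instance Definition _ :=
  isMultiplicative.Build G (G * H)%type inj_prodl inj_prodlM.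

End DirectProduct.

(** The system has one variable for each position in [s]. Since no constants of [A] occur, [K] can
    be arbitrary: [A * K] serves only as a group that contains [A] and maps onto [K]. *)
Lemma algebraically_closed_local_embedding (A K : groupType) (s : seq K) :
  algebraically_closed A -> uniq s ->
  exists f : K -> A, {in s &, injective f} /\
    {in s &, forall a b, (a * b)%g \in s -> f (a * b)%g = (f a * f b)%g}.
Proof.
move=> Acl s_uniq; pose n := size s; pose e (i : 'I_n) : K := nth 1%g s i.
have e_inj : injective e.
  by move=> i j /eqP; rewrite /e nth_uniq // => /eqP/val_inj.
pose V := @Var A n.
pose eqs := [seq (Mul (V p.1.1) (V p.1.2), V p.2)
  | p <- enum {: 'I_n * 'I_n * 'I_n} & (e p.1.1 * e p.1.2 == e p.2)%g].
pose neqs := [seq (V p.1, V p.2) | p <- enum {: 'I_n * 'I_n} & p.1 != p.2].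
have [|x []] := Acl n (GSystem eqs neqs).
  exists (A * K)%type, (@inj_prodl A K); split; first by move=> a b [].
  (* The second coordinates alone satisfy the system, so the first ones can be trivial. *)
  exists (fun i => (1%g, e i)); rewrite !all_map; split; apply/allP => p;
    rewrite mem_filter => /andP[pP _] /=.
    by apply/eqP; congr (_, _); [exact: mulg1 | exact/eqP].
  by apply: contra pP => /eqP[/e_inj ->].
rewrite !all_map => /allP xeqs /allP xneqs.
have sP a : a \in s -> exists i, e i = a.
  move=> sa; have lt_i : (index a s < n)%N by rewrite index_mem.
  by exists (Ordinal lt_i); rewrite /e /= nth_index.
(* The solution [x] becomes a function on all of [K]: well defined on [s] because [e] is injective,
   and with the default value 1 elsewhere. *)
have /choice[r rK] (a : K) : exists b : A, forall i, e i = a -> b = x i.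
  have [[i <-]|no] := pselect (exists i, e i = a).
    by exists (x i) => j /e_inj ->.
  by exists 1%g => i ei; case: no; exists i.
exists r; split=> a b /sP[i <-] /sP[j <-].
  rewrite (rK _ i erefl) (rK _ j erefl) => xij; congr e; apply/eqP/negP => /negP nij.
  have /= := xneqs (i, j); rewrite mem_filter /= nij mem_enum xij eqxx.
  by move/(_ isT).
move=> /sP[k ek]; rewrite (rK _ i erefl) (rK _ j erefl) (rK _ k ek); apply/esym/eqP.
apply: (xeqs ((i, j), k)).
by rewrite mem_filter /= ek eqxx mem_enum.
Qed.

(** By induction on [s]: a bijection that is right on [s] is corrected at a new point [a] by
    composing it with the transposition of [g a] and [f a]. *)
Lemma extend_partial_injection (S T : eqType) (g0 : S -> T) (s : seq S)
    (f : S -> T) :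
  bijective g0 -> {in s &, injective f} ->
  exists2 g : S -> T, bijective g & {in s, g =1 f}.
Proof.
move=> g0_bij; elim: s => [|a s IHs] f_inj; first by exists g0.
have [|g g_bij gf] := IHs.
  by move=> x y sx sy; apply: f_inj; rewrite inE ?sx ?sy orbT.
have [sa|nsa] := boolP (a \in s).
  by exists g => // x; rewrite inE => /predU1P[->|]; apply: gf.
pose swap y := if y == g a then f a else if y == f a then g a else y.
have swapK : involutive swap.
  move=> y; rewrite /swap; case: (eqVneq y (g a)) => [->|yga].
    by case: eqVneq => [->|_]; rewrite ?eqxx.
  by case: (eqVneq y (f a)) => [->|yfa]; rewrite ?eqxx // (negPf yga) (negPf yfa).
exists (swap \o g); first by apply: bij_comp g_bij; exists swap.
move=> x; rewrite inE => /predU1P[->|sx] /=; first by rewrite /swap eqxx.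
(* The transposition fixes [g x = f x], which differs from [g a] by injectivity of [g] and from
   [f a] by injectivity of [f] on [a :: s]. *)
have xa : x != a by apply: contraNneq nsa => <-.
rewrite /swap (inj_eq (bij_inj g_bij)) (negPf xa) gf //.
case: eqP => // fxa; case/eqP: xa.
by apply: f_inj fxa; rewrite inE ?sx ?eqxx ?orbT.
Qed.

Lemma posnat_bijection (A : Type) :
  countable [set: A] -> infinite_set [set: A] ->
  exists g : posnat -> A, bijective g.
Proof.
move=> Acnt Ainf; have /card_esym := eq_card_nat Acnt Ainf.
move=> /card_bijP[g [h gK hK]].
(* A shift by one, since [posnat] starts at 1 and [nat] at 0. *)
pose p (i : posnat) : [set: nat] := SigSub (in_setT (sval i).-1).
pose q (n : [set: nat]) : posnat := exist (fun n => (0 < n)%N) (val n).+1 isT.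
have pK : cancel p q by case=> -[|n] ? //; apply: val_inj.
have qK : cancel q p by move=> n; apply: val_inj.
exists (val \o g \o p); exists (q \o h \o (fun a => SigSub (in_setT a))) => x /=.
  by rewrite (_ : SigSub _ = g (p x)) ?gK ?pK//; apply: val_inj.
by rewrite qK hK.
Qed.

Section Transport.
Variables (A : groupType) (g : posnat -> A) (h : A -> posnat).
Hypotheses (gK : cancel g h) (hK : cancel h g) (g1 : g pos1 = 1%g).

Definition transport_table : table := fun p => h (g p.1 * g p.2)%g.

Lemma transport_tableP : group_tables transport_table.
Proof.
split=> [x y z|x|x|x]; rewrite /table_mul /transport_table /=.
- by rewrite !hK mulgA.
- by rewrite g1 mul1g gK.
- by rewrite g1 mulg1 gK.
- by exists (h (g x)^-1%g); rewrite hK mulVg mulgV -g1 gK.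
Qed.

Definition transport_group : group_tables :=
  exist _ transport_table (mem_set transport_tableP).

Let transportM : {morph (g : table_group transport_group -> A) :
  x y / (x * y)%g}.
Proof. by move=> x y; apply: hK. Qed.

Lemma transport_isomorphic : isomorphic (table_group transport_group) A.
Proof.
pose m := isMultiplicative.Build (table_group transport_group) A g transportM.
pose f : {multiplicative table_group transport_group -> A} :=
  HB.pack (g : table_group transport_group -> A) m.
by exists f; exists h.
Qed.

End Transport.

(** The functions that agree with [f] on a finite list form a filter base. The product topology is a
    supremum of topologies induced by evaluations, so convergence of this filter to [f] is checked
    one coordinate at a time, where a one-element list suffices. *)
Lemma nbhs_ptws_finite (X : eqType) (Y : topologicalType) (f : {ptws X -> Y})
    (U : set {ptws X -> Y}) :
  nbhs f U -> exists s : seq X,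
    forall g : {ptws X -> Y}, (forall x, x \in s -> g x = f x) -> U g.
Proof.
pose cyl (s : seq X) : set {ptws X -> Y} :=
  [set g | forall x, x \in s -> g x = f x].
pose F := filter_from [set: seq X] cyl.
have FF : Filter F.
  apply: filter_from_filter; first by exists [::].
  move=> s t _ _; exists (s ++ t) => // g gf.
  by split=> x xs; apply: gf; rewrite mem_cat xs ?orbT.
suff Ff : F --> f by move=> /Ff[s _ sU]; exists s.
apply/cvg_sup => i B [_ [[C Copen <-] Cfi] CB].
by exists [:: i] => // g gf; apply: CB; rewrite /= gf ?inE.
Qed.

Theorem theorem3p13 (A : groupType)
    (A_countable : countable [set: A]) (A_infinite : infinite_set [set: A])
    (A_closed : algebraically_closed A) :
  dense [set G : group_tables | isomorphic (table_group G) A].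
Proof.
(* [O] is the trace on [group_tables] of an open set [B] of tables. *)
move=> O [G OG] [B Bopen BO]; rewrite -BO in OG *.
have /nbhs_ptws_finite[s sB] : nbhs (set_val G) B by exact: open_nbhs_nbhs.
pose K : groupType := table_group G.
(* Arguments and values of the prescribed entries. The identity is added so that [1 * 1 = 1] forces
   [f 1 = 1], which keeps the identity of the transported table at [pos1]. *)
pose t : seq K :=
  undup (1%g :: flatten [seq ([:: p.1; p.2; set_val G p] : seq K) | p <- s]).
have [f [f_inj fM]] : exists f : K -> A, {in t &, injective f} /\
    {in t &, forall a b, (a * b)%g \in t -> f (a * b)%g = (f a * f b)%g}.
  exact: (algebraically_closed_local_embedding A_closed (undup_uniq _)).
have t1 : (1%g : K) \in t by rewrite mem_undup mem_head.
have f1 : f 1%g = 1%g.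
  by apply: (mulgI (f 1%g)); rewrite -fM ?mulg1.
have [g0 g0_bij] := posnat_bijection A_countable A_infinite.
have [g [h gK hK] gf] := extend_partial_injection (S := K) g0_bij f_inj.
have g1 : g pos1 = 1%g by rewrite -f1 -gf.
exists (transport_group gK hK g1); split; last exact: transport_isomorphic.
apply: sB => -[i j] ps.
have tp x : x \in [:: i; j; set_val G (i, j)] -> x \in t.
  move=> xp; rewrite mem_undup inE; apply/orP; right; apply/flatten_mapP.
  by exists (i, j).
have ti : i \in t by apply: tp; rewrite !inE eqxx.
have tj : j \in t by apply: tp; rewrite !inE eqxx orbT.
have tij : set_val G (i, j) \in t by apply: tp; rewrite !inE eqxx !orbT.
rewrite /transport_group set_valE /= /transport_table /=.
(* With products [i * j] taken in [K]: [h (g i * g j) = h (f i * f j) = h (f (i * j)) = h (g (i *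
   j)) = i * j]. *)
by rewrite gf // gf // -(fM i j) // -gf // gK.
Qed.
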